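(* Fix $q\in(0,1)$ and let $(\Gamma_n)_{n\ge1}$ be a sequence of finite simple graphs. For each $n$ let $U_n\subseteq v(\Gamma_n)$ be a vertex cover of $\Gamma_n$, $\tau_n=|U_n|$, and $H_n=\Gamma_n[U_n]$ the induced subgraph. Let $Q_n$ be a sequence of query budgets. Assume that, as $n\to\infty$, $$\sup_{\mathcal Q_n\subseteq\binom{[n]}{2}:\,|\mathcal Q_n|\le Q_n} d_{\mathrm{TV}}\left(\mathbb P_{H_n,\mathcal Q_n},\mathbb P_{\mathcal H_0,\mathcal Q_n}\right)\to 0$$ and $$\sup_{\mathcal Q_n\subseteq\binom{[n]}{2}:\,|\mathcal Q_n|\le Q_n}\ \frac{1}{(n-\tau_n)^2}\sum_{r=1}^{\tau_n}(q^{-1}-1)^r\,\Theta_{r,n}\,\zeta_{r,n}(\mathcal Q_n)\to 0 .$$ Then weak detection is impossible with $Q_n$ non-adaptive queries.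
   Context: Setup. $\Gamma_n$ is a finite simple undirected graph without isolated vertices and with at least one edge, with $|v(\Gamma_n)|\le n$. Under $\mathcal H_0$, $G$ is a random graph on $[n]=\{1,\dots,n\}$ in which each pair in $\binom{[n]}{2}$ is an edge independently with probability $q$. Under $\mathcal H_1$, a copy $\Gamma_n^\star$ is drawn uniformly from the set of all subgraphs of the complete graph on $[n]$ isomorphic to $\Gamma_n$; all edges of $\Gamma_n^\star$ are in $G$, and every other pair is an edge independently with probability $q$. For a query set $\mathcal Q\subseteq\binom{[n]}{2}$ (chosen non-adaptively), the transcript is $G_{\mathcal Q}=(\mathbf 1\{e\in e(G)\})_{e\in\mathcal Q}$, and $\mathbb P_{\mathcal H_0,\mathcal Q}$, $\mathbb P_{\mathcal H_1,\mathcal Q}$ are its laws under $\mathcal H_0,\mathcal H_1$. The optimal risk under budget $Q_n$ is $R^\star_{n,Q_n}=1-\sup_{|\mathcal Q|\le Q_n} d_{\mathrm{TV}}(\mathbb P_{\mathcal H_1,\mathcal Q},\mathbb P_{\mathcal H_0,\mathcal Q})$. Weak detection is impossible with $Q_n$ non-adaptive queries if $\lim_{n\to\infty}R^\star_{n,Q_n}=1$. Notation for the statement. A vertex cover is a set of vertices meeting every edge. $W_n=v(\Gamma_n)\setminus U_n$. For $w\in W_n$, $N_n(w)\subseteq U_n$ is the set of neighbors of $w$ in $\Gamma_n$ lying in $U_n$. For $1\le r\le\tau_n$, $$\Theta_{r,n}=\sum_{w,w'\in W_n}\binom{|N_n(w)\cap N_n(w')|}{r}$$ (sum over all ordered pairs,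 including $w=w'$). For a query set $\mathcal Q$ and $i\in[n]$, $t_i(\mathcal Q)=|\{j\in[n]\setminus\{i\}:\{i,j\}\in\mathcal Q\}|$, and $$\zeta_{r,n}(\mathcal Q)=\sum_{i=1}^n\frac{(t_i(\mathcal Q))_r}{(n)_r},\qquad (a)_r=a(a-1)\cdots(a-r+1).$$ When $W_n=\emptyset$ all $\Theta_{r,n}$ vanish and the expression in the second hypothesis is read as $0$. The auxiliary law $\mathbb P_{H_n,\mathcal Q}$ is the law of the transcript $G_{\mathcal Q}$ when $G$ is generated as follows: draw a uniformly random injective map $\varphi_n:U_n\to[n]$; all edges $\{\varphi_n(u),\varphi_n(u')\}$ with $\{u,u'\}\in e(H_n)$ are present, and every other pair in $\binom{[n]}{2}$ is an edge independently with probability $q$. *)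

(* Defs.v *)
From HB Require Import structures.
From mathcomp Require Import all_boot all_order all_algebra.
From mathcomp Require Import boolp classical_sets reals topology normedtype sequences.

Set Implicit Arguments.
Unset Strict Implicit.
Unset Printing Implicit Defensive.

Import Order.TTheory GRing.Theory Num.Theory.
Import numFieldNormedType.Exports.

Local Open Scope set_scope.
Local Open Scope ring_scope.

Record sgraph := SGraph {
  vert :> finType;
  adj : rel vert;
  adj_sym : symmetric adj;
  adj_irr : irreflexive adj }.

Arguments adj {s} : rename.

Definition no_isolated (Gam : sgraph) : Prop :=
  forall x : Gam, exists y : Gam, adj x y.

Definition has_edge (Gam : sgraph) : Prop :=
  exists x y : Gam, adj x y.

Definition vertex_cover (Gam : sgraph) (U : {set Gam}) : Prop :=
  forall x y : Gam, adj x y -> (x \in U) || (y \in U).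

Section Induced.
Variables (Gam : sgraph) (U : {set Gam}).
Let iadj : rel {x : Gam | x \in U} := fun x y => adj (val x) (val y).
Let iadj_sym : symmetric iadj. Proof. by move=> x y; exact: adj_sym. Qed.
Let iadj_irr : irreflexive iadj. Proof. by move=> x; exact: adj_irr. Qed.
Definition induced : sgraph := SGraph iadj_sym iadj_irr.
End Induced.

(* The unordered pairs binom([n], 2).  Edge sets of graphs on [n], query sets
   and outcomes of a random graph on [n] are all elements of {set vpair n}. *)
Definition vpair (n : nat) : finType := {e : {set 'I_n} | #|e| == 2%N}.

Definition linked n (F : {set vpair n}) (i j : 'I_n) : bool :=
  [exists e in F, val e == [set i; j]].

(* A subgraph of the complete graph on [n] is a pair (vertex set, edge set)
   in which the end points of every edge belong to the vertex set. *)
Definition is_subgraph n (S : {set 'I_n} * {set vpair n}) : bool :=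
  [forall e in S.2, val e \subset S.1].

Definition is_copy (Gam : sgraph) n (S : {set 'I_n} * {set vpair n}) : bool :=
  [exists f : {ffun Gam -> 'I_n},
    [&& injectiveb f, f @: [set: Gam] == S.1 &
        [forall x, forall y, adj x y == linked S.2 (f x) (f y)]]].

Definition copies (Gam : sgraph) n : {set {set 'I_n} * {set vpair n}} :=
  [set S | is_subgraph S && is_copy Gam S].

Definition embeddings (Gam : sgraph) n : {set {ffun Gam -> 'I_n}} :=
  [set phi : {ffun Gam -> 'I_n} | injectiveb phi].

Definition image_edges (Gam : sgraph) n (phi : {ffun Gam -> 'I_n}) :
    {set vpair n} :=
  [set e : vpair n |
    [exists x, exists y, adj x y && (val e == [set phi x; phi y])]].

(* Laws on a finite type are given by their probability mass functions. *)
Section Laws.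
Variable R : realType.

Definition bern (p : R) (b : bool) : R := if b then p else 1 - p.

Definition unif_mixture (I T : finType) (A : {set I}) (P : I -> T -> R) :
    T -> R :=
  fun t => (#|A|%:R)^-1 * \sum_(i in A) P i t.

Definition pushforward (S T : finType) (f : S -> T) (P : S -> R) : T -> R :=
  fun t => \sum_(s | f s == t) P s.

Definition dTV (T : finType) (P P' : T -> R) : R :=
  2^-1 * \sum_t `|P t - P' t|.

Definition null_law n (q : R) (G : {set vpair n}) : R :=
  \prod_(e : vpair n) bern q (e \in G).

Definition planted_law n (q : R) (F G : {set vpair n}) : R :=
  \prod_(e : vpair n) bern (if e \in F then 1 else q) (e \in G).

Definition copy_law (Gam : sgraph) n (q : R) : {set vpair n} -> R :=
  unif_mixture (copies Gam n) (fun S => planted_law q S.2).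

Definition embedding_law (H : sgraph) n (q : R) : {set vpair n} -> R :=
  unif_mixture (embeddings H n) (fun phi => planted_law q (image_edges phi)).

Definition transcript n (Q G : {set vpair n}) : {ffun {e | e \in Q} -> bool} :=
  [ffun e => val e \in G].

Definition transcript_law n (Q : {set vpair n}) (P : {set vpair n} -> R) :
    {ffun {e | e \in Q} -> bool} -> R :=
  pushforward (transcript Q) P.

Arguments transcript_law {n} Q P _.

(* Supremum over the finitely many query sets of size at most B; the base value
   at the empty query set is itself one of the values in range. *)
Definition sup_budget n (B : nat) (f : {set vpair n} -> R) : R :=
  \big[Num.max/f finset.set0]_(Q : {set vpair n} | (#|Q| <= B)%N) f Q.

Definition opt_risk (Gam : sgraph) n (q : R) (B : nat) : R :=
  1 - sup_budget B (fun Q : {set vpair n} =>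
    dTV (transcript_law Q (copy_law Gam q))
        (transcript_law Q (null_law q))).

Definition weak_detection_impossible
    (Gam : nat -> sgraph) (q : R) (B : nat -> nat) : Prop :=
  ((fun n => @opt_risk (Gam n) n q (B n)) @ \oo --> (1 : R))%classic.

Definition query_degree n (Q : {set vpair n}) (i : 'I_n) : nat :=
  #|[set j : 'I_n | (j != i) && linked Q i j]|.

Definition zeta n (r : nat) (Q : {set vpair n}) : R :=
  \sum_(i < n) (query_degree Q i ^_ r)%:R / (n ^_ r)%:R.

End Laws.

Arguments transcript_law {R n} Q P _.

Definition nbrs_in (Gam : sgraph) (U : {set Gam}) (w : Gam) : {set Gam} :=
  [set u in U | adj w u].

Definition Theta (Gam : sgraph) (U : {set Gam}) (r : nat) : nat :=
  (\sum_(w in ~: U) \sum_(w' in ~: U)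
     'C(#|nbrs_in U w :&: nbrs_in U w'|, r))%N.

(* Main.v *)
(* By exchangeability a uniform copy of Gamma may be replaced by a uniform
   embedding phi.  Condition on the restriction of phi to the vertex cover U: the
   planted law and its core version then share the core edges, and the second
   moment of their likelihood ratio is the mean of q^-|overlap| over two
   independent completions phi, phi', where the overlap consists of the queried
   edges {x, phi u} with x = phi w = phi' w' and u a common neighbour of w and w'.
   Expanding over the sets of triples (w, w', x), and bounding by
   (16 / (n - |U|)^2)^s the probability that s given triples are all realised,
   bounds this second moment by prod (1 + 16 g / (n - |U|)^2), where
   g = q^-a - 1 and a counts the u with {x, phi u} queried.  The mean over phi|_U
   of the sum of the g / (n - |U|)^2 is exactly the quantity assumed to vanish.
   The bound |z| <= eta + z^2 / eta passes from the second moment to total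
   variation linearly, so that it can be averaged over phi|_U. *)
Require Import Defs.
From HB Require Import structures.
From mathcomp Require Import all_boot all_order all_algebra.
From mathcomp Require Import boolp classical_sets reals topology normedtype sequences.
From mathcomp Require Import zify ring lra.

Set Implicit Arguments.
Unset Strict Implicit.
Unset Printing Implicit Defensive.

Import Order.TTheory GRing.Theory Num.Theory.
Import numFieldNormedType.Exports.
Local Open Scope set_scope.
Local Open Scope ring_scope.

(** * Falling factorials *)

Section Counting.
Local Open Scope nat_scope.

Lemma ffactD n r s : n ^_ (r + s) = n ^_ r * (n - r) ^_ s.
Proof.
elim: r n => [|r IHr] n; first by rewrite ffactn0 mul1n subn0.
case: n => [|n]; first by rewrite addSn !ffact0n.
by rewrite addSn !ffactSS IHr mulnA subSS.
Qed.

(** Each factor of [(s + s) ^_ s] is at least [s], and this falling factorial is [s!] times a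
    central binomial coefficient, itself at most 2^(2s). *)
Lemma expn_self_le_fact s : s ^ s <= 4 ^ s * s`!.
Proof.
have le_ffact : s ^ s <= (s + s) ^_ s.
  rewrite ffact_prod -[X in _ ^ X](card_ord s) -prod_nat_const.
  by apply: leq_prod => i _; have := ltn_ord i; lia.
apply: leq_trans le_ffact _; rewrite -bin_ffact leq_mul2r; apply/orP; right.
have -> : 4 ^ s = 2 ^ (s + s) by rewrite addnn -muln2 mulnC expnM.
have := @expnDn 1 1 (s + s); rewrite add1n => ->.
have lt_s : s < (s + s).+1 by lia.
rewrite (bigD1 (Ordinal lt_s)) //= !exp1n !muln1; exact: leq_addr.
Qed.

(** Turns the exact probability 1 / [n ^_ s] of prescribing [s] values of a random injection into a
    power. The loss of 4 per value, incurred for two independent completions, produces the constant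
    16 of the second moment bound. *)
Lemma expn_le_ffact n s : s <= n -> n ^ s <= 4 ^ s * n ^_ s.
Proof.
case: s => [|s]; first by rewrite !expn0 ffactn0.
move=> le_sn; rewrite -(@leq_pmul2r (s.+1 ^ s.+1)) ?expn_gt0 //.
(* n ^_ s / n ^ s increases with n, so the worst case is n = s. *)
have scaled : n ^ s.+1 * s.+1`! <= n ^_ s.+1 * s.+1 ^ s.+1.
  rewrite -ffactnn !ffact_prod -[X in n ^ X](card_ord s.+1).
  rewrite -[X in _ * s.+1 ^ X](card_ord s.+1) -!prod_nat_const -!big_split /=.
  by apply: leq_prod => i _; have := ltn_ord i; nia.
rewrite -mulnA (leq_trans _ (leq_mul (leqnn _) scaled)) //.
by rewrite mulnCA leq_mul2l expn_self_le_fact orbT.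
Qed.

(** * Counting injections with prescribed values *)

Section Injections.
Variables V T : finType.
Implicit Types (A S : {set V}) (phi : {ffun V -> T}).

(** A total [f] stands for a partial map with domain [A]: its values off [A] do not enter. *)
Definition extensions A (f : V -> T) : {set {ffun V -> T}} :=
  [set phi : {ffun V -> T} | injectiveb phi & [forall v in A, phi v == f v]].

Lemma extensionsP A f phi :
  reflect (injective phi /\ {in A, phi =1 f}) (phi \in extensions A f).
Proof.
rewrite inE; apply: (iffP andP) => [[/injectiveP inj /eqfun_inP eq_f]|[inj eq_f]].
  by split.
by split; [exact/injectiveP | exact/eqfun_inP].
Qed.

(** Induction on the number of free vertices. A free [v] may be sent to any point outside [f @: A],
    and each choice leaves an extension problem for [v |: A], whose prescribed map is [f']. *)
Lemma card_extensions A f : {in A &, injective f} ->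
  #|extensions A f| = (#|T| - #|A|) ^_ (#|V| - #|A|).
Proof.
have [k] := ubnP #|~: A|; elim: k => // k IHk in A f * => ltAk injf.
have [A_full|[v vA]] := finset.set_0Vmem (~: A).
  have {}A_full u : u \in A by rewrite -[A]finset.setCK A_full !inE.
  rewrite (eq_card (B := predT) A_full) subnn ffactn0 -(cards1 (finfun f)); apply: eq_card => phi.
  rewrite finset.in_set1; apply/extensionsP/eqP => [[_ eq_f]|->].
    by apply/ffunP => u; rewrite ffunE eq_f ?inE.
  by split=> [u w|u _]; rewrite !ffunE // => /injf; apply; apply: A_full.
pose f' x := fun u => if u == v then x else f u.
rewrite inE in vA.
have f'A x : {in A, f' x =1 f}.
  by move=> u uA; rewrite /f'; case: eqP uA vA => // -> ->.
have f'v x : f' x v = x by rewrite /f' eqxx.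
rewrite -sum1_card (partition_big (fun phi : {ffun V -> T} => phi v) (mem (~: (f @: A)))) /=;
  last first.
  move=> phi /extensionsP[inj eq_f]; rewrite inE.
  apply: contra vA => /imsetP[u uA].
  by rewrite -eq_f // => /inj ->.
have sizeVA : #|V| - #|A| = (#|V| - #|v |: A|).+1.
  by rewrite cardsU1 vA; have := max_card (mem (v |: A)); rewrite cardsU1 vA /=; lia.
transitivity (\sum_(x in ~: (f @: A)) (#|T| - #|v |: A|) ^_ (#|V| - #|v |: A|)).
  apply: eq_bigr => x; rewrite inE => xA; rewrite -(IHk (v |: A) (f' x)).
  - rewrite -sum1_card; apply: eq_bigl => phi.
    apply/andP/extensionsP => [[/extensionsP[inj eq_f] /eqP <-]|[inj eq_f]].
      by split=> // u /finset.setU1P[->|uA]; rewrite ?f'v // f'A ?eq_f.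
    split; last by rewrite eq_f ?finset.setU11 // f'v.
    by apply/extensionsP; split=> // u uA; rewrite eq_f ?finset.setU1r // f'A.
  - have := ltAk; rewrite (cardsD1 v (~: A)) inE vA /= => lt.
    rewrite (_ : ~: (v |: A) = (~: A) :\ v); first by lia.
    by apply/setP => u; rewrite !inE negb_or.
  - move=> u w /finset.setU1P[->|uA] /finset.setU1P[->|wA]; rewrite ?f'v ?f'A //;
      last by apply: injf.
      by move=> x_eq; rewrite x_eq imset_f in xA.
    by move=> x_eq; rewrite -x_eq imset_f in xA.
rewrite sum_nat_const cardsCs finset.setCK card_in_imset // sizeVA.
by rewrite cardsU1 vA ffactnS /= add1n subnS.
Qed.

Definition restrict S phi : {ffun {v | v \in S} -> T} := [ffun v => phi (val v)].

Lemma card_restrict_fiber (x0 : T) S (g : {ffun {v | v \in S} -> T}) :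
  injective g ->
  #|[set phi : {ffun V -> T} | injectiveb phi & restrict S phi == g]| =
  (#|T| - #|S|) ^_ (#|V| - #|S|).
Proof.
(* [x0] fills in the values off [S], so that [g] becomes a total map as [extensions] requires. *)
move=> injg; pose f v := if insub v is Some u then g u else x0.
have fS (v : {v | v \in S}) : f (val v) = g v by rewrite /f valK.
rewrite -(@card_extensions S f); last first.
  move=> u w uS wS; rewrite -[u]/(val (Sub u uS : {v | v \in S})).
  by rewrite -[w]/(val (Sub w wS : {v | v \in S})) !fS => /injg ->.
apply: eq_card => phi; rewrite inE.
apply/andP/extensionsP => [[/injectiveP inj /eqP eq_g]|[inj eq_f]].
  split=> // v vS; rewrite -[v]/(val (Sub v vS : {v | v \in S})) fS.
  by rewrite -eq_g ffunE.
split; first exact/injectiveP.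
by apply/eqP/ffunP => v; rewrite ffunE eq_f ?fS // (valP v).
Qed.

(** Group by the restriction to [S]: it ranges over the injections of [S] into [D], and each of them
    has the same number of extensions. *)
Lemma card_injections_into S (D : {set T}) (x0 : T) :
  #|[set phi : {ffun V -> T} | injectiveb phi & [forall v in S, phi v \in D]]| =
  #|D| ^_ #|S| * (#|T| - #|S|) ^_ (#|V| - #|S|).
Proof.
pose inj_to := [set g : {ffun {v | v \in S} -> T} in ffun_on D | injectiveb g].
have -> : #|S| = #|{: {v | v \in S}}| by rewrite card_sig; apply: eq_card => v.
rewrite -card_inj_ffuns_on -sum1_card.
rewrite (partition_big (restrict S) (mem inj_to)) /=; last first.
  move=> phi; rewrite !inE => /andP[/injectiveP inj /forall_inP phiD].
  apply/andP; split; last by apply/injectiveP => u w; rewrite !ffunE => /inj/val_inj.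
  by apply/ffun_onP => v; rewrite ffunE phiD ?(valP v).
rewrite -sum_nat_const; apply: eq_bigr => g.
rewrite inE => /andP[/ffun_onP gD /injectiveP injg].
rewrite sum1_card (_ : #|{: {v | v \in S}}| = #|S|); last first.
  by rewrite card_sig; apply: eq_card.
rewrite -(card_restrict_fiber x0 injg).
apply: eq_card => phi; rewrite unfold_in !inE.
have [/= eq_g|] := eqVneq (restrict S phi) g; last by rewrite !andbF.
rewrite !andbT (_ : [forall v in S, phi v \in D]) ?andbT //.
apply/forall_inP => v vS; have := gD (Sub v vS).
by rewrite -eq_g ffunE.
Qed.

End Injections.

End Counting.

(** * Averages over finite sets *)

Section Mean.
Variable R : numFieldType.
Variable I : finType.
Implicit Types (A : {set I}) (h : I -> R).

Definition mean A h : R := (#|A|%:R)^-1 * \sum_(i in A) h i.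

Lemma eq_mean A h h' : {in A, h =1 h'} -> mean A h = mean A h'.
Proof. by move=> eq_h; rewrite /mean (eq_bigr h') // => i /eq_h. Qed.

Lemma mean_const A c : A != finset.set0 -> mean A (fun=> c) = c.
Proof.
move=> A0; rewrite /mean sumr_const -[X in _ * X]mulr_natl mulrA mulVf ?mul1r //.
by rewrite pnatr_eq0 cards_eq0.
Qed.

Lemma meanZ A c h : mean A (fun i => c * h i) = c * mean A h.
Proof. by rewrite /mean -mulr_sumr mulrCA. Qed.

Lemma meanB A h h' : mean A (fun i => h i - h' i) = mean A h - mean A h'.
Proof. by rewrite /mean sumrB mulrBr. Qed.

Lemma meanD A h h' : mean A (fun i => h i + h' i) = mean A h + mean A h'.
Proof. by rewrite /mean big_split mulrDr. Qed.

Lemma mean_sum (J : Type) (r : seq J) (P : pred J) A (h : J -> I -> R) :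
  mean A (fun i => \sum_(j <- r | P j) h j i) = \sum_(j <- r | P j) mean A (h j).
Proof. by rewrite /mean exchange_big mulr_sumr. Qed.

Lemma ler_mean A h h' : {in A, forall i, h i <= h' i} -> mean A h <= mean A h'.
Proof. by move=> le_h; rewrite ler_wpM2l ?invr_ge0 ?ler0n // ler_sum. Qed.

Lemma mean_ge0 A h : {in A, forall i, 0 <= h i} -> 0 <= mean A h.
Proof. by move=> h0; rewrite mulr_ge0 ?invr_ge0 ?ler0n // sumr_ge0. Qed.

Lemma ler_norm_mean A h : `|mean A h| <= mean A (fun i => `|h i|).
Proof.
rewrite /mean normrM ger0_norm ?invr_ge0 ?ler0n //.
by rewrite ler_wpM2l ?invr_ge0 ?ler0n // ler_norm_sum.
Qed.

Lemma mean_mul (A : {set I}) h h' :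
  mean A (fun i => mean A (fun j => h i * h' j)) = mean A h * mean A h'.
Proof.
rewrite [RHS]mulrC -meanZ; apply: eq_mean => i _.
by rewrite meanZ mulrC.
Qed.

Lemma mean_indicator A (P : pred I) :
  mean A (fun i => (P i)%:R) = #|[set i in A | P i]|%:R / #|A|%:R.
Proof.
rewrite /mean mulrC; congr (_ / _).
rewrite -sum1_card natr_sum big_mkcond [RHS]big_mkcond /=.
by apply: eq_bigr => i _; rewrite !inE; case: (i \in A); case: (P i).
Qed.

(** The tower property of conditional expectation, conditioning on the value of [r]: the weights 1 /
    |class| collected by a point over its own class add up to 1. *)
Lemma mean_classes (J : eqType) (r : I -> J) A h :
  mean A h = mean A (fun i => mean [set i' in A | r i' == r i] h).
Proof.
rewrite /mean; congr (_ * _).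
under [RHS]eq_bigr => i iA do rewrite mulr_sumr.
rewrite (exchange_big_dep (mem A)) /=; last by move=> i i' _; rewrite inE => /andP[].
apply: eq_bigr => i' i'A.
rewrite (eq_bigr (fun=> (#|[set i in A | r i == r i']|%:R)^-1 * h i')); last first.
  move=> i /andP[_]; rewrite inE => /andP[_ /eqP <-].
  by [].
rewrite sumr_const (_ : #|_| = #|[set i in A | r i == r i']|); last first.
  by apply: eq_card => i; rewrite unfold_in !inE i'A /= eq_sym.
rewrite -[RHS]mulr_natl mulrA mulfV ?mul1r // pnatr_eq0 cards_eq0.
by apply/set0Pn; exists i'; rewrite inE i'A eqxx.
Qed.

End Mean.

(** A map with fibres of constant size carries the uniform law on [A] to the uniform law on [A']. It
    serves twice: from embeddings to copies, and from embeddings of the graph to embeddings of its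
    core. *)
Lemma mean_fibers (R : numFieldType) (I J : finType) (A : {set I}) (A' : {set J})
    (r : I -> J) (c : nat) (h : J -> R) :
    (0 < c)%N -> {in A, forall i, r i \in A'} ->
    {in A', forall j, #|[set i in A | r i == j]| = c} ->
  mean A (h \o r) = mean A' h.
Proof.
move=> c0 rA cardr.
have cardE j : j \in A' -> (\sum_(i in A | r i == j) 1 = c)%N.
  by move=> jA'; rewrite sum1_card -(cardr j jA'); apply: eq_card => i; rewrite !inE.
rewrite /mean (partition_big r (mem A')) //=.
have -> : #|A| = (#|A'| * c)%N.
  rewrite -sum1_card (partition_big r (mem A')) //= (eq_bigr (fun=> c)) //.
  by rewrite sum_nat_const.
rewrite (eq_bigr (fun j => c%:R * h j)); last first.
  move=> j jA'; rewrite (eq_bigr (fun=> h j)); last by move=> i /andP[_ /eqP <-].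
  by rewrite sumr_const -[LHS]mulr_natl -[in RHS](cardE j jA') sum1_card.
rewrite -mulr_sumr natrM invfM -mulrA; congr (_ * _); rewrite mulrA mulVf ?mul1r //.
by rewrite pnatr_eq0 -lt0n.
Qed.

(** * Product laws, likelihood ratios and their second moments *)

Section ProductLaw.
Variables (R : realType) (q : R) (E : finType).
Hypotheses (q_gt0 : 0 < q) (q_lt1 : q < 1).
Implicit Types (F D : {set E}) (t : {ffun E -> bool}).

(** The planted law over an arbitrary finite index set, so that it can also describe the transcript
    on the queried pairs alone. *)
Definition planted_pmf F t : R := \prod_e bern (if e \in F then 1 else q) (t e).

(** The likelihood ratio for planting [D] on top of a disjoint planted set. *)
Definition planted_ratio D t : R := \prod_e (if e \in D then (t e)%:R / q else 1).

Lemma bern_ge0 (p : R) b : 0 <= p <= 1 -> 0 <= bern p b.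
Proof. by case: b => /=; lra. Qed.

Lemma planted_pmf_ge0 F t : 0 <= planted_pmf F t.
Proof.
apply: prodr_ge0 => e _; apply: bern_ge0; case: ifP => _; first by rewrite ler01 lexx.
by rewrite (ltW q_gt0) (ltW q_lt1).
Qed.

Lemma planted_pmfU F D t : [disjoint F & D] ->
  planted_pmf (F :|: D) t = planted_pmf F t * planted_ratio D t.
Proof.
move=> /pred0P disjFD; rewrite -big_split; apply: eq_bigr => e _ /=.
have := disjFD e; rewrite /= inE.
case: (e \in F) => /= [->|_]; first by rewrite mulr1.
case: (e \in D) => /=; last by rewrite mulr1.
by case: (t e); rewrite /= ?mul1r ?mulfV ?gt_eqF // subrr mul0r mulr0.
Qed.

(** The sum factorises over coordinates. A coordinate in both [D] and [D'] gives q / q^2 = 1 / q,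
    and every other one gives 1. *)
Lemma sum_planted_ratio2 F D D' : [disjoint F & D] -> [disjoint F & D'] ->
  \sum_t planted_pmf F t * (planted_ratio D t * planted_ratio D' t) =
  q^-1 ^+ #|D :&: D'|.
Proof.
move=> /pred0P dD /pred0P dD'.
pose h e b := bern (if e \in F then 1 else q) b *
  ((if e \in D then b%:R / q else 1) * (if e \in D' then b%:R / q else 1)) : R.
rewrite (eq_bigr (fun t : {ffun E -> bool} => \prod_e h e (t e))); last first.
  by move=> t _; rewrite -!big_split.
rewrite -bigA_distr_bigA -prodr_const [RHS]big_mkcond /=.
apply: eq_bigr => e _; rewrite big_bool /h /= inE.
have qN0 : q != 0 by rewrite gt_eqF.
move: (dD e) (dD' e) => /=.
by case: (e \in F) => /= [-> ->|_ _]; [|case: (e \in D); case: (e \in D')] => /=; field.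
Qed.

Lemma sum_planted_ratio F D : [disjoint F & D] ->
  \sum_t planted_pmf F t * planted_ratio D t = 1.
Proof.
move=> dD; rewrite -[1](expr0 q^-1) -(cards0 E) -(finset.setI0 D).
rewrite -(@sum_planted_ratio2 F) //; last by apply/pred0P => e; rewrite /= inE andbF.
apply: eq_bigr => t _; rewrite [planted_ratio finset.set0 t]big1 ?mulr1 // => e _.
by rewrite inE.
Qed.

Lemma sum_planted_pmf F : \sum_t planted_pmf F t = 1.
Proof.
rewrite -(@sum_planted_ratio F finset.set0); last first.
  by apply/pred0P => e; rewrite /= inE andbF.
apply: eq_bigr => t _; rewrite [planted_ratio finset.set0 t]big1 ?mulr1 // => e _.
by rewrite inE.
Qed.

(** The mixture has density [L] with respect to the law planted on [F]. Since [L] has mean 1, its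
    variance is its second moment minus 1, and squaring the average defining [L] yields the double
    mean over two independent indices. *)
Lemma planted_mixture_L1_le (I : finType) (A : {set I}) F (D : I -> {set E}) (eta : R) :
    0 < eta -> A != finset.set0 -> {in A, forall i, [disjoint F & D i]} ->
  \sum_t `|mean A (fun i => planted_pmf (F :|: D i) t) - planted_pmf F t| <=
  eta + (mean A (fun i => mean A (fun j => q^-1 ^+ #|D i :&: D j|)) - 1) / eta.
Proof.
move=> eta0 A0 dFD; pose L t := mean A (fun i => planted_ratio (D i) t).
have abs_le (z : R) : `|z| <= eta + z ^+ 2 / eta.
  rewrite -(ler_pM2r eta0) mulrDl divfK ?gt_eqF // -real_normK ?num_real //.
  by have := normr_ge0 z; nra.
apply: (@le_trans _ _ (\sum_t planted_pmf F t * (eta + (L t - 1) ^+ 2 / eta))).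
  apply: ler_sum => t _.
  have -> : mean A (fun i => planted_pmf (F :|: D i) t) = planted_pmf F t * L t.
    by rewrite -meanZ; apply: eq_mean => i iA; rewrite planted_pmfU ?dFD.
  rewrite -[X in _ - X]mulr1 -mulrBr normrM ger0_norm ?planted_pmf_ge0 //.
  by rewrite ler_wpM2l ?planted_pmf_ge0.
(* What remains is an identity: expand the square and evaluate the three sums. *)
rewrite le_eqVlt; apply/orP; left; apply/eqP; rewrite (eq_bigr (fun t => eta * planted_pmf F t +
  eta^-1 * (planted_pmf F t * (L t * L t) - 2 * (planted_pmf F t * L t)
            + planted_pmf F t))); last first.
  by move=> t _; ring.
rewrite big_split /= -!mulr_sumr big_split /= sumrB -mulr_sumr sum_planted_pmf mulr1.
have -> : \sum_t planted_pmf F t * L t = 1.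
  under eq_bigr => t _ do rewrite -meanZ.
  rewrite -mean_sum -[RHS](@mean_const R _ A 1) //.
  by apply: eq_mean => i iA; rewrite sum_planted_ratio ?dFD.
have -> : \sum_t planted_pmf F t * (L t * L t) =
    mean A (fun i => mean A (fun j => q^-1 ^+ #|D i :&: D j|)).
  under eq_bigr => t _ do rewrite -mean_mul -meanZ.
  rewrite -mean_sum; apply: eq_mean => i iA.
  under eq_bigr => t _ do rewrite -meanZ.
  rewrite -mean_sum; apply: eq_mean => j jA.
  by rewrite sum_planted_ratio2 ?dFD.
by field; rewrite gt_eqF.
Qed.

(** The fallback for conditioning classes on which the second moment is not under control. *)
Lemma planted_mixture_L1_le2 (I : finType) (A : {set I}) F (D : I -> {set E}) :
    A != finset.set0 ->
  \sum_t `|mean A (fun i => planted_pmf (F :|: D i) t) - planted_pmf F t| <= 2.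
Proof.
move=> A0.
apply: (@le_trans _ _ (\sum_t (mean A (fun i => planted_pmf (F :|: D i) t) + planted_pmf F t))).
  apply: ler_sum => t _; apply: le_trans (ler_normB _ _) _.
  by rewrite !ger0_norm ?planted_pmf_ge0 ?mean_ge0 // => i _; rewrite planted_pmf_ge0.
rewrite big_split /= sum_planted_pmf -mean_sum.
rewrite (eq_mean (h' := fun=> 1)) ?mean_const // => i _.
exact: sum_planted_pmf.
Qed.

End ProductLaw.

(** * Laws of transcripts *)

Section Transcript.
Variables (R : realType) (n : nat) (Q : {set vpair n}).

Lemma transcript_planted (q : R) (F : {set vpair n}) t :
  transcript_law Q (planted_law q F) t = planted_pmf q [set e | val e \in F] t.
Proof.
pose p e : R := if e \in F then 1 else q.
(* [P e] is the set of outcomes at [e] compatible with [t]: forced on queried pairs, free elsewhere.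
   The graphs with transcript [t] thus form a product set, and the sum over them factorises. *)
pose P e b := if insub e is Some e' then b == t e' else true.
rewrite /transcript_law /pushforward.
rewrite (reindex (fun f : {ffun vpair n -> bool} => [set e | f e])); last first.
  apply: onW_bij; exists (fun G : {set vpair n} => [ffun e => e \in G]) => [f|G].
    by apply/ffunP => e; rewrite ffunE inE.
  by apply/setP => e; rewrite inE ffunE.
rewrite (eq_bigr (fun f : {ffun vpair n -> bool} => \prod_e bern (p e) (f e))); last first.
  by move=> f _; apply: eq_bigr => e _; rewrite inE.
rewrite (eq_bigl (mem (family P))); last first.
  move=> f; apply/eqP/familyP => [def_t e|fP].
    by rewrite unfold_in /P -def_t; case: insubP => // e' _ <-; rewrite ffunE inE.
  apply/ffunP => e; have := fP (val e); rewrite unfold_in /P valK ffunE inE.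
  by move/eqP.
rewrite -(bigA_distr_big_dep P (fun e b => bern (p e) b)) (bigID (mem Q)) /=.
(* An unqueried pair contributes p + (1 - p) = 1. *)
rewrite [X in _ * X]big1 ?mulr1 => [|e eQ]; last first.
  by rewrite /P insubN // big_bool /=; ring.
rewrite big_sub; apply: eq_bigr => e _.
rewrite /P valK big_pred1_eq /p inE.
by [].
Qed.

Lemma transcript_mixture (I : finType) (A : {set I}) (P : I -> {set vpair n} -> R) t :
  transcript_law Q (unif_mixture A P) t = mean A (fun i => transcript_law Q (P i) t).
Proof.
by rewrite /transcript_law /pushforward /unif_mixture mean_sum.
Qed.

End Transcript.

(** * Uniform copies and uniform embeddings *)

Section CopyLaw.
Variables (R : realType) (Gam : sgraph) (n : nat) (q : R).
Implicit Types (f g : {ffun Gam -> 'I_n}) (e : vpair n).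

Lemma embeddingsP f : reflect (injective f) (f \in embeddings Gam n).
Proof. by rewrite inE; exact: injectiveP. Qed.

Lemma image_edgesP f e :
  reflect (exists x y, adj x y /\ val e = [set f x; f y]) (e \in image_edges f).
Proof.
rewrite inE; apply: (iffP existsP) => [[x /existsP[y /andP[xy /eqP ?]]]|[x [y [xy E]]]].
  by exists x, y.
by exists x; apply/existsP; exists y; rewrite xy E eqxx.
Qed.

Lemma set2_eq (T : finType) (a b c d : T) :
  [set a; b] = [set c; d] -> (a = c /\ b = d) \/ (a = d /\ b = c).
Proof.
move=> E.
have /finset.set2P aE : a \in [set c; d] by rewrite -E finset.set21.
have /finset.set2P bE : b \in [set c; d] by rewrite -E finset.set22.
have /finset.set2P cE : c \in [set a; b] by rewrite E finset.set21.
have /finset.set2P dE : d \in [set a; b] by rewrite E finset.set22.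
by case: aE bE cE dE => ? [] ? [] ? [] ?;
   first [by left; split; congruence | by right; split; congruence].
Qed.

Lemma linkedP (F : {set vpair n}) i j :
  reflect (exists2 e, e \in F & val e = [set i; j]) (linked F i j).
Proof. exact: 'exists_in_eqP. Qed.

Lemma vpair_neq e i j : val e = [set i; j] -> i != j.
Proof. by move=> E; have := valP e; rewrite E cards2; case: (i != j). Qed.

Lemma vpair_of i j : i != j -> exists e : vpair n, val e = [set i; j].
Proof.
move=> ij; have card2 : #|[set i; j]| == 2%N by rewrite cards2 ij.
by exists (Sub [set i; j] card2); rewrite SubK.
Qed.

Lemma linked_image f x y : injective f -> linked (image_edges f) (f x) (f y) = adj x y.
Proof.
move=> inj; apply/linkedP/idP => [[e /image_edgesP[x' [y' [x'y' ->]]]]|xy].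
  by case/set2_eq => [] [/inj <- /inj <-] //; rewrite adj_sym.
have /vpair_of[e eE] : f x != f y.
  by apply: contraTneq xy => /inj ->; rewrite adj_irr.
by exists e => //; apply/image_edgesP; exists x, y.
Qed.

Definition embedding_copy f : {set 'I_n} * {set vpair n} :=
  (f @: [set: Gam]%SET, image_edges f).

Lemma copiesP (S : {set 'I_n} * {set vpair n}) :
  reflect (exists2 f : {ffun Gam -> 'I_n}, injective f & embedding_copy f = S) (S \in copies Gam n).
Proof.
rewrite inE; apply: (iffP andP) => [[/forall_inP subS /existsP[f]]|[f inj <-]]; last first.
  split.
    apply/forall_inP => e /image_edgesP[x [y [_ ->]]].
    by apply/fintype.subsetP => i /finset.set2P[] ->; rewrite imset_f ?inE.
  apply/existsP; exists f; apply/and3P; split => //; first exact/injectiveP.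
  by apply/'forall_forallP => x y; rewrite linked_image.
case/and3P => /injectiveP inj /eqP imf /'forall_'forall_eqP adjE.
exists f => //; rewrite /embedding_copy imf [RHS]surjective_pairing; congr (_, _).
apply/setP => e; apply/image_edgesP/idP => [[x [y [xy eE]]]|eS].
  have := adjE x y; rewrite xy => /esym/linkedP[e' e'S e'E].
  by rewrite (_ : e = e') //; apply: val_inj; rewrite e'E.
(* The subgraph condition places both end points of [e] in the image of [f], so [e] comes from a
   pair of vertices of [Gam]. *)
have /fintype.subsetP := subS e eS; have /cards2P[i [j [ij eE]]] := valP e.
rewrite eE -imf => sub_ij.
have /imsetP[x _ xE] := sub_ij i (finset.set21 _ _).
have /imsetP[y _ yE] := sub_ij j (finset.set22 _ _).
exists x, y; rewrite -xE -yE; split=> //; rewrite adjE.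
by apply/linkedP; exists e => //; rewrite -xE -yE.
Qed.

(** For injective [f0] these are the compositions of [f0] with the automorphisms of [Gam]. *)
Definition copy_fiber f0 : {set {ffun Gam -> 'I_n}} :=
  [set f in embeddings Gam n | embedding_copy f == embedding_copy f0].

Lemma copy_fiberP f0 f :
  reflect [/\ injective f, f @: [set: Gam]%SET = f0 @: [set: Gam]%SET
            & image_edges f = image_edges f0] (f \in copy_fiber f0).
Proof.
rewrite inE; apply: (iffP andP) => [[/embeddingsP ? /eqP[]]|[? eqV eqE]] //.
by split; [exact/embeddingsP | rewrite /embedding_copy eqV eqE].
Qed.

(** Used in both directions, it shows that every copy is the image of equally many embeddings. *)
Lemma copy_fiber_le f0 g0 : injective f0 -> injective g0 ->
  (#|copy_fiber f0| <= #|copy_fiber g0|)%N.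
Proof.
move=> injf0 injg0.
(* f |-> g0 \o f0^-1 \o f injects one fiber into the other. *)
pose al f (x : Gam) := odflt x [pick y | f0 y == f x].
have f0al f x : f \in copy_fiber f0 -> f0 (al f x) = f x.
  case/copy_fiberP => _ imE _.
  have /imsetP[y _ yE] : f x \in f0 @: [set: Gam]%SET by rewrite -imE imset_f ?inE.
  by rewrite /al; case: pickP => [z /eqP //|/(_ y)]; rewrite yE eqxx.
pose th f := [ffun x => g0 (al f x)].
have injth : {in copy_fiber f0 &, injective th}.
  move=> f f' fF f'F /ffunP E; apply/ffunP => x.
  have := E x; rewrite !ffunE => /injg0 alE.
  by rewrite -(f0al f x fF) alE f0al.
apply: (@leq_trans #|th @: copy_fiber f0|); first by rewrite (card_in_imset injth).
apply: subset_leq_card.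
apply/fintype.subsetP => _ /imsetP[f fF ->].
have [inj _ eqE] := copy_fiberP _ _ fF.
have adjal x y : adj (al f x) (al f y) = adj x y.
  rewrite -(linked_image _ _ injf0) (f0al f x fF) (f0al f y fF) -eqE.
  by rewrite linked_image.
have injal : injective (al f).
  by move=> x y alE; apply: inj; rewrite -(f0al f x fF) -(f0al f y fF) alE.
have [be alK beK] := injF_bij injal.
apply/copy_fiberP; split.
  by move=> x y; rewrite !ffunE => /injg0/injal.
  apply/setP => i; apply/imsetP/imsetP => [[x _ ->]|[x _ ->]].
    by exists (al f x); rewrite ?inE ?ffunE.
  by exists (be x); rewrite ?inE ?ffunE ?beK.
apply/setP => e; apply/image_edgesP/image_edgesP => [[x [y [xy ->]]]|[x [y [xy ->]]]].
  by exists (al f x), (al f y); rewrite adjal !ffunE.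
by exists (be x), (be y); rewrite !ffunE !beK -adjal !beK.
Qed.

Lemma copy_law_embedding : copy_law Gam q = @embedding_law R Gam n q.
Proof.
apply/funext => G; rewrite /copy_law /embedding_law /unif_mixture.
(* Without embeddings there are no copies, and both mixtures are empty sums. *)
have [emb0|[f0 /embeddingsP injf0]] := finset.set_0Vmem (embeddings Gam n).
  have -> : copies Gam n = finset.set0.
    apply/setP => S; rewrite [RHS]inE; apply/copiesP => -[f /embeddingsP].
    by rewrite emb0 inE.
  by rewrite emb0 !big_set0 !mulr0.
symmetry.
apply: (@mean_fibers R _ _ (embeddings Gam n) (copies Gam n) embedding_copy
  #|copy_fiber f0|
  (fun S => planted_law q S.2 G)).
- by apply/card_gt0P; exists f0; exact/copy_fiberP.
- by move=> f /embeddingsP inj; apply/copiesP; exists f.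
- move=> _ /copiesP[f inj <-].
  apply/eqP; rewrite eqn_leq.
  by apply/andP; split; [apply: (@copy_fiber_le f f0) | apply: (@copy_fiber_le f0 f)].
Qed.

End CopyLaw.

(** * Restriction of an embedding to the vertex cover *)

Section Conditioning.
Variables (R : realType) (Gam : sgraph) (n : nat) (q : R) (U : {set Gam}).
Hypothesis Gam_small : (#|Gam| <= n)%N.
Implicit Types (phi : {ffun Gam -> 'I_n}) (e : vpair n).

Lemma card_embeddings : #|embeddings Gam n| = (n ^_ #|Gam|)%N.
Proof. by rewrite /embeddings card_inj_ffuns card_ord. Qed.

Lemma embeddings_neq0 : embeddings Gam n != finset.set0.
Proof. by rewrite -card_gt0 card_embeddings ffact_gt0. Qed.

Definition core_edges phi : {set vpair n} :=
  [set e : vpair n | [exists x in U, [exists y in U, adj x y && (val e == [set phi x; phi y])]]].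

Definition cross_edges phi : {set vpair n} :=
  [set e : vpair n | [exists w in ~: U, [exists u in U, adj w u && (val e == [set phi w; phi u])]]].

Lemma core_edgesP phi e :
  reflect (exists x y, [/\ x \in U, y \in U, adj x y & val e = [set phi x; phi y]])
    (e \in core_edges phi).
Proof.
rewrite inE; apply: (iffP exists_inP) => [[x xU /exists_inP[y yU /andP[xy /eqP ?]]]|].
  by exists x, y.
by case=> x [y [xU yU xy E]]; exists x => //; apply/exists_inP; exists y; rewrite // xy E eqxx.
Qed.

Lemma cross_edgesP phi e :
  reflect (exists w u, [/\ w \notin U, u \in U, adj w u & val e = [set phi w; phi u]])
    (e \in cross_edges phi).
Proof.
rewrite inE; apply: (iffP exists_inP) => [[x xU /exists_inP[y yU /andP[xy /eqP ?]]]|].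
  by exists x, y; move: xU; rewrite inE.
case=> x [y [xU yU xy E]]; exists x; rewrite ?inE //.
by apply/exists_inP; exists y; rewrite // xy E eqxx.
Qed.

Lemma image_edges_induced phi :
  image_edges (restrict U phi : {ffun induced U -> 'I_n}) = core_edges phi.
Proof.
apply/setP => e; apply/image_edgesP/core_edgesP.
  by case=> x [y [xy ->]]; exists (val x), (val y); rewrite !ffunE (valP x) (valP y).
case=> x [y [xU yU xy ->]].
by exists (Sub x xU : {x | x \in U}), (Sub y yU : {x | x \in U}); rewrite !ffunE.
Qed.

(** Every injection of [U] into [n] extends to the same number of embeddings of [Gam], so the
    restriction of a uniform embedding to [U] is uniform. Both laws can then be averaged over the
    same [phi]. *)
Lemma embedding_law_induced (x0 : 'I_n) G :
  embedding_law (induced U) q G =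
  mean (embeddings Gam n) (fun phi => planted_law q (core_edges phi) G).
Proof.
rewrite /embedding_law /unif_mixture -/(mean _ _).
have leUV : (#|U| <= #|Gam|)%N by exact: max_card.
rewrite -(@mean_fibers R _ _ (embeddings Gam n) (embeddings (induced U) n) (restrict U)
  ((n - #|U|) ^_ (#|Gam| - #|U|))).
- by apply: eq_mean => phi _ /=; rewrite image_edges_induced.
- by rewrite ffact_gt0; lia.
- move=> phi /embeddingsP inj; apply/embeddingsP => x y; rewrite !ffunE.
  by move/inj/val_inj.
- move=> g /embeddingsP injg; rewrite -[X in (X - _)%N](card_ord n).
  rewrite -(card_restrict_fiber x0 injg).
  by apply: eq_card => phi; rewrite !inE.
Qed.

(** * Edges shared by two completions of one core *)

Section OverlapEdges.
Hypothesis U_cover : vertex_cover U.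
Variable phi0 : {ffun Gam -> 'I_n}.

Lemma image_edges_split phi : {in U, phi =1 phi0} ->
  image_edges phi = core_edges phi0 :|: cross_edges phi.
Proof.
move=> eqU; apply/setP => e; rewrite finset.in_setU.
apply/image_edgesP/orP => [[x [y [xy E]]]|].
  have [xU|xU] := boolP (x \in U); have [yU|yU] := boolP (y \in U).
  - by left; apply/core_edgesP; exists x, y; rewrite -!eqU.
  - right; apply/cross_edgesP; exists y, x; rewrite adj_sym; split=> //.
    by rewrite E finset.setUC.
  - by right; apply/cross_edgesP; exists x, y.
  - by have := U_cover xy; rewrite (negPf xU) (negPf yU).
case=> [/core_edgesP[x [y [xU yU xy E]]]|/cross_edgesP[x [y [xU yU xy E]]]].
  by exists x, y; rewrite !eqU.
by exists x, y.
Qed.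

Lemma core_cross_disjoint phi e : injective phi -> {in U, phi =1 phi0} ->
  e \in core_edges phi0 -> e \notin cross_edges phi.
Proof.
move=> inj eqU /core_edgesP[x [y [xU yU _ E]]].
apply/negP => /cross_edgesP[w [u [wU uU _]]].
rewrite E -!eqU // => /set2_eq[[/inj xE _]|[_ /inj yE]].
  by rewrite -xE xU in wU.
by rewrite -yE yU in wU.
Qed.

Variable Q : {set vpair n}.

Definition query_nbrs (i : 'I_n) : {set 'I_n} := [set j | (j != i) && linked Q i j].

(** A triple [t] reads (w, w', x), with x a candidate common image of w and w' under two
    completions. *)
Definition overlap (t : Gam * Gam * 'I_n) : {set Gam} :=
  [set u in nbrs_in U t.1.1 :&: nbrs_in U t.1.2 | phi0 u \in query_nbrs t.2].

Definition matched phi phi' (t : Gam * Gam * 'I_n) : bool :=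
  (phi t.1.1 == t.2) && (phi' t.1.2 == t.2).

Definition outside (t : Gam * Gam * 'I_n) : bool :=
  (t.1.1 \notin U) && (t.1.2 \notin U).

(** A shared cross edge has one end x = [phi w] = [phi' w'] and the other end [phi0 u] for a common
    neighbour u. It is thus recovered from a matched triple and an element of its overlap, and the
    sum counts all such choices. *)
Lemma card_common_cross phi phi' :
    injective phi -> injective phi' -> {in U, phi =1 phi0} -> {in U, phi' =1 phi0} ->
  (#|[set e : {e | e \in Q} | val e \in cross_edges phi] :&:
     [set e : {e | e \in Q} | val e \in cross_edges phi']| <=
   \sum_(t | outside t && matched phi phi' t) #|overlap t|)%N.
Proof.
move=> inj inj' eqU eqU'; set C := _ :&: _.
pose P := [set p : Gam * Gam * 'I_n * Gam |
  outside p.1 && matched phi phi' p.1 & p.2 \in overlap p.1].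
pose h (p : Gam * Gam * 'I_n * Gam) : {set 'I_n} := [set p.1.2; phi0 p.2].
have -> : (\sum_(t | outside t && matched phi phi' t) #|overlap t| = #|P|)%N.
  rewrite -sum1_card (eq_bigr (fun t => \sum_(u in overlap t) 1)%N); last first.
    by move=> t _; rewrite sum1_card.
  by rewrite pair_big_dep /=; apply: eq_bigl => p; rewrite [RHS]inE.
pose v (e : {e | e \in Q}) : {set 'I_n} := val (val e).
have injv : injective v by move=> x y /val_inj/val_inj.
rewrite -(card_imset _ injv).
apply: leq_trans (leq_imset_card h P); apply: subset_leq_card.
apply/fintype.subsetP => _ /imsetP[e eC ->].
case/finset.setIP: eC; rewrite inE => /cross_edgesP[w [u [wU uU wu E]]].
rewrite inE => /cross_edgesP[w' [u' [w'U u'U wu' E']]].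
(* The end points cannot match crosswise: [phi w = phi' u' = phi u'] would put w in [U]. *)
have [ww uu] : phi w = phi' w' /\ u = u'.
  move: E'; rewrite E => /set2_eq[[-> uE]|[wE _]].
    by split=> //; apply: inj'; rewrite -uE (eqU u uU) eqU'.
  by move: wE; rewrite (eqU' u' u'U) -(eqU u' u'U) => /inj wE; rewrite wE u'U in wU.
apply/imsetP; exists (w, w', phi w, u); last by rewrite /v /h E /= (eqU u uU).
subst u'; rewrite !inE /outside /matched /= wU w'U -ww eqxx uU wu wu' /=.
have EQ : val (val e) = [set phi w; phi0 u] by rewrite E (eqU u uU).
rewrite eq_sym (vpair_neq EQ); apply/linkedP; exists (val e) => //; exact: valP.
Qed.

End OverlapEdges.

(** * Probabilities given the embedded core *)

Section ClassCounts.
Variable phi0 : {ffun Gam -> 'I_n}.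
Hypothesis phi0_inj : injective phi0.

Definition core_class : {set {ffun Gam -> 'I_n}} :=
  [set phi in embeddings Gam n | restrict U phi == restrict U phi0].

Lemma core_classE : core_class = extensions U phi0.
Proof.
apply/setP => phi; rewrite inE.
apply/andP/extensionsP => [[/embeddingsP inj /eqP/ffunP eqU]|[inj eqU]].
  split=> // u uU; have := eqU (Sub u uU); by rewrite !ffunE.
split; first exact/embeddingsP.
by apply/eqP/ffunP => u; rewrite !ffunE eqU // (valP u).
Qed.

Lemma core_class_neq0 : core_class != finset.set0.
Proof. by apply/finset.set0Pn; exists phi0; rewrite inE eqxx andbT; apply/embeddingsP. Qed.

(** The probability is a ratio of two extension counts, from [U :|: S] and from [U]; with N = n -
    |U| and s = |S| it equals 1 / [N ^_ s] exactly. *)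
Lemma mean_agree (S : {set Gam}) phi1 : S \subset ~: U -> phi1 \in core_class ->
  mean core_class (fun phi => [forall w in S, phi w == phi1 w]%:R) <=
  (4 / (n - #|U|)%:R) ^+ #|S| :> R.
Proof.
move=> SU; rewrite core_classE => /extensionsP[inj1 eqU].
have disjUS : [disjoint U & S] by rewrite disjoint_sym finset.disjoints_subset.
have cardUS : #|U :|: S| = (#|U| + #|S|)%N.
  by apply/eqP; have [_ ->] := leq_card_setU U S.
have leUS : (#|U| + #|S| <= #|Gam|)%N by rewrite -cardUS max_card.
rewrite mean_indicator.
have -> : [set phi in extensions U phi0 | [forall w in S, phi w == phi1 w]] =
    extensions (U :|: S) phi1.
  apply/setP => phi; rewrite inE.
  apply/andP/extensionsP => [[/extensionsP[inj eqU'] /eqfun_inP eqS]|[inj eqUS]].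
    by split=> // x /finset.setUP[xU|/eqS //]; rewrite eqU' // eqU.
  split; last by apply/eqfun_inP => w wS; rewrite eqUS // inE wS orbT.
  by apply/extensionsP; split=> // u uU; rewrite eqUS ?eqU // inE uU.
rewrite !card_extensions ?card_ord ?cardUS => [|u v _ _ /phi0_inj //|u v _ _ /inj1 //].
set N := (n - #|U|)%N; set s := #|S|.
have -> : (#|Gam| - #|U| = s + (#|Gam| - (#|U| + s)))%N by rewrite /s; lia.
have -> : (n - (#|U| + s) = N - s)%N by rewrite /N /s; lia.
rewrite ffactD natrM.
set b := ((N - s) ^_ _)%N.
have b0 : (0 < b)%N by rewrite ffact_gt0 /N /s; lia.
have sN : (s <= N)%N by rewrite /s /N; lia.
have a0 : (0 < N ^_ s)%N by rewrite ffact_gt0.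
rewrite invfM mulrCA mulfV ?mulr1 ?pnatr_eq0 -?lt0n //.
(* If [U] has [n] vertices, the quotient 4 / N is degenerate, but then s = 0 and both sides are
   1. *)
have [N0|N0] := posnP N.
  have -> : s = 0%N by lia.
  by rewrite expr0 ffactn0 invr1 lexx.
rewrite expr_div_n ler_pdivlMr ?exprn_gt0 ?ltr0n // mulrC ler_pdivrMr ?ltr0n //.
by rewrite -!natrX -natrM ler_nat expn_le_ffact.
Qed.

(** If no pair of completions realises [M], the mean is 0. Otherwise one realising pair records the
    values that any other must take, and independence of the two completions gives one factor (4 /
    N)^|M| for each. *)
Lemma mean_matched (M : {set Gam * Gam * 'I_n}) : {in M, forall t, outside t} ->
  mean core_class (fun phi => mean core_class (fun phi' =>
    [forall t in M, matched phi phi' t]%:R)) <=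
  (16 / (n - #|U|)%:R ^+ 2) ^+ #|M| :> R.
Proof.
move=> outM.
have [/existsP[phi1 /existsP[phi2 /and3P[phi1C phi2C /forall_inP match12]]]|none] :=
    boolP [exists phi, exists phi', [&& phi \in core_class, phi' \in core_class &
      [forall t in M, matched phi phi' t]]]; last first.
  rewrite [X in X <= _](_ : _ = 0); first
    by rewrite exprn_ge0 // divr_ge0 ?ler0n // exprn_ge0 ?ler0n.
  rewrite /mean big1 ?mulr0 // => phi phiC.
  rewrite big1 ?mulr0 // => phi' phi'C; case: (boolP [forall t in M, _]) => // M_match.
  by case/existsP: none; exists phi; apply/existsP; exists phi'; rewrite phiC phi'C.
have inj1 : injective phi1 by move: phi1C; rewrite core_classE => /extensionsP[].
have inj2 : injective phi2 by move: phi2C; rewrite core_classE => /extensionsP[].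
have matchE t : t \in M -> phi1 t.1.1 = t.2 /\ phi2 t.1.2 = t.2.
  by move/match12 => /andP[/eqP ? /eqP ?].
pose S1 := [set t.1.1 | t in M]; pose S2 := [set t.1.2 | t in M].
(* A jointly realisable M is a partial matching, so both projections are injective. *)
have card1 : #|S1| = #|M|.
  apply: card_in_imset => -[[w w'] x] [[v v'] y] /matchE[/= <- e2] /matchE[/= <- e4] /= wv.
  by subst v; rewrite (inj2 w' v') ?e2 ?e4.
have card2 : #|S2| = #|M|.
  apply: card_in_imset => -[[w w'] x] [[v v'] y] /matchE[/= e1 e2] /matchE[/= e3 e4] /= wv.
  subst v'; have ew : w = v by apply: inj1; rewrite e1 e3 -e2.
  by rewrite ew -e2 -e4.
have S1U : S1 \subset ~: U.
  by apply/fintype.subsetP => _ /imsetP[t /outM/andP[? _] ->]; rewrite inE.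
have S2U : S2 \subset ~: U.
  by apply/fintype.subsetP => _ /imsetP[t /outM/andP[_ ?] ->]; rewrite inE.
have -> : 16 / (n - #|U|)%:R ^+ 2 = 4 / (n - #|U|)%:R * (4 / (n - #|U|)%:R) :> R.
  by rewrite expr2 invfM; ring.
rewrite exprMn -{1}card1 -card2.
apply: le_trans (ler_pM _ _ (mean_agree S1U phi1C) (mean_agree S2U phi2C));
  rewrite ?mean_ge0 //; try by move=> *; rewrite ler0n.
rewrite -mean_mul; apply: ler_mean => phi _; apply: ler_mean => phi' _.
rewrite -natrM ler_nat mulnb; case: (boolP [forall t in M, _]) => // /forall_inP mM.
rewrite lt0b; apply/andP; split; apply/eqfun_inP => _ /imsetP[t tM ->].
  by have [-> _] := matchE t tM; have /andP[/eqP -> _] := mM t tM.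
by have [_ ->] := matchE t tM; have /andP[_ /eqP ->] := mM t tM.
Qed.

End ClassCounts.

End Conditioning.

(** * Second moment and total variation within one class *)

Lemma prod_1D_le (R : realFieldType) (I : Type) (r : seq I) (b : I -> R) :
    (forall i, 0 <= b i) -> \sum_(i <- r) b i <= 2^-1 ->
  \prod_(i <- r) (1 + b i) <= 1 + 2 * \sum_(i <- r) b i.
Proof.
move=> b0; elim: r => [|i r IHr]; first by rewrite !big_nil; lra.
rewrite !big_cons => small; have bi0 := b0 i.
have S0 : 0 <= \sum_(j <- r) b j by rewrite sumr_ge0.
have /IHr le_r : \sum_(j <- r) b j <= 2^-1 by lra.
(* With S the remaining sum, (1 + b)(1 + 2S) <= 1 + 2(b + S) amounts to 2bS <= b, which S <= 1/2
   ensures. *)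
have := ler_wpM2l (_ : 0 <= 1 + b i) le_r; move/(_ ltac:(lra)).
by move=> /le_trans; apply; nra.
Qed.

Section ClassSecondMoment.
Variables (R : realType) (Gam : sgraph) (n : nat) (q : R) (U : {set Gam}).
Hypotheses (Gam_small : (#|Gam| <= n)%N) (U_cover : vertex_cover U).
Hypotheses (q_gt0 : 0 < q) (q_lt1 : q < 1).
Variable Q : {set vpair n}.
Implicit Types (phi : {ffun Gam -> 'I_n}) (t : Gam * Gam * 'I_n).

(** A realised triple multiplies the second moment bound by 1 + [excess]. The indicator lets sums
    and products range over all triples. *)
Definition excess phi0 t : R :=
  (outside U t)%:R * (q^-1 ^+ #|overlap U phi0 Q t| - 1).

Let N : R := (n - #|U|)%:R.

Definition mean_excess phi0 : R := (N ^+ 2)^-1 * \sum_t excess phi0 t.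

Definition query_edges (F : {set vpair n}) : {set {e | e \in Q}} := [set e | val e \in F].

Lemma mem_query_edges F e : (e \in query_edges F) = (val e \in F).
Proof. by rewrite inE. Qed.

Let invq_ge1 : 1 <= q^-1.
Proof. by rewrite invf_ge1 ?ltW. Qed.

Lemma excess_ge0 phi0 t : 0 <= excess phi0 t.
Proof. by rewrite mulr_ge0 ?ler0n // subr_ge0 exprn_ege1. Qed.

Lemma mean_excess_ge0 phi0 : 0 <= mean_excess phi0.
Proof.
rewrite mulr_ge0 ?invr_ge0 ?exprn_ge0 ?ler0n // sumr_ge0 // => t _.
exact: excess_ge0.
Qed.

Lemma class_second_moment phi0 : injective phi0 ->
  mean (core_class U phi0) (fun phi => mean (core_class U phi0) (fun phi' =>
    q^-1 ^+ #|query_edges (cross_edges U phi) :&: query_edges (cross_edges U phi')|)) <=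
  \prod_t (1 + 16 / N ^+ 2 * excess phi0 t).
Proof.
move=> inj0; have classE := core_classE U phi0.
pose c : R := 16 / N ^+ 2.
have c0 : 0 <= c by rewrite mulr_ge0 ?invr_ge0 ?exprn_ge0 ?ler0n.
pose X (M : {set Gam * Gam * 'I_n}) : R := \prod_(t in M) excess phi0 t.
have X0 M : 0 <= X M by apply: prodr_ge0 => t _; exact: excess_ge0.
apply: (@le_trans _ _ (mean (core_class U phi0) (fun phi => mean (core_class U phi0)
    (fun phi' => \sum_(M : {set Gam * Gam * 'I_n})
       X M * [forall t in M, matched phi phi' t]%:R)))).
  apply: ler_mean => phi; rewrite classE => /extensionsP[inj eqU].
  apply: ler_mean => phi' /extensionsP[inj' eqU'].
  apply: le_trans (ler_weXn2l invq_ge1 (card_common_cross Q inj inj' eqU eqU')) _.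
  rewrite -prodrXr big_mkcond /=.
  (* In this form the product expands over the sets [M] of triples, with the randomness confined to
     the event that all of [M] is matched. *)
  rewrite (eq_bigr (fun t => (matched phi phi' t)%:R * excess phi0 t + 1)); last first.
    move=> t _; rewrite /excess; case: (outside U t); case: (matched phi phi' t);
      by rewrite /= ?mul1r ?mul0r ?mulr0 ?add0r ?subrK.
  rewrite bigA_distr; apply: ler_sum => M _.
  rewrite -big_mkcond /= big_split /= mulrC ler_wpM2l ?X0 //.
  have [/forall_inP all_m|] := boolP [forall t in M, matched phi phi' t].
    by rewrite big1 // => t /all_m ->.
  rewrite negb_forall_in => /exists_inP[t tM /negPf m_t].
  by rewrite (bigD1 t) //= m_t mul0r.
(* The target expands over the same sets, which allows a comparison one [M] at a time. *)
have -> : \prod_t (1 + c * excess phi0 t) =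
    \sum_(M : {set Gam * Gam * 'I_n}) c ^+ #|M| * X M.
  rewrite (eq_bigr (fun t => c * excess phi0 t + 1)); last by move=> t _; rewrite addrC.
  rewrite bigA_distr; apply: eq_bigr => M _.
  by rewrite -big_mkcond big_split /= prodr_const.
under eq_mean => phi _ do rewrite mean_sum.
rewrite mean_sum; apply: ler_sum => M _.
under eq_mean => phi _ do rewrite meanZ.
rewrite meanZ mulrC.
(* A set [M] with a triple meeting [U] has weight [X M] = 0. *)
have [/forall_inP outM|] := boolP [forall t in M, outside U t].
  by rewrite ler_wpM2r // mean_matched.
rewrite negb_forall_in => /exists_inP[t tM /negPf out_t].
by rewrite /X (bigD1 t) //= /excess out_t !mul0r !mulr0.
Qed.

Lemma class_L1_le phi0 (eta : R) : 0 < eta -> eta <= 1 -> injective phi0 ->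
  \sum_s `|mean (core_class U phi0) (fun phi =>
             transcript_law Q (planted_law q (image_edges phi)) s)
           - transcript_law Q (planted_law q (core_edges U phi0)) s| <=
  eta + 64 / eta * mean_excess phi0.
Proof.
move=> eta0 eta1 inj0; have classE := core_classE U phi0.
have class0 := core_class_neq0 U inj0.
pose F := query_edges (core_edges U phi0).
pose D phi := query_edges (cross_edges U phi).
have disj : {in core_class U phi0, forall phi, [disjoint F & D phi]}.
  move=> phi; rewrite classE => /extensionsP[inj eqU].
  apply/pred0P => e; apply/negP => /andP[/=].
  rewrite mem_query_edges => /(core_cross_disjoint inj eqU)/negP eD.
  by rewrite mem_query_edges.
rewrite (eq_bigr (fun s => `|mean (core_class U phi0) (fun phi => planted_pmf q (F :|: D phi) s)
    - planted_pmf q F s|)); last first.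
  move=> s _; rewrite transcript_planted; congr `|_ - _|.
  apply: eq_mean => phi; rewrite classE => /extensionsP[inj eqU].
  rewrite transcript_planted (image_edges_split U_cover eqU); congr planted_pmf.
  apply/setP => e.
  rewrite [LHS](mem_query_edges (core_edges U phi0 :|: cross_edges U phi)).
  rewrite finset.in_setU [RHS]finset.in_setU.
  by congr (_ || _); rewrite mem_query_edges.
have inv_eta : 1 <= eta^-1 by rewrite invf_ge1.
set S := mean_excess phi0; have S0 : 0 <= S := mean_excess_ge0 phi0.
(* The threshold is the one required by [prod_1D_le], which gives 32 S / eta. Above it 64 S > 2, so
   as eta <= 1 the trivial bound 2 suffices; this case fixes the constant 64. *)
have [small|big] := lerP (16 * S) 2^-1; last first.
  apply: le_trans (planted_mixture_L1_le2 q_gt0 q_lt1 _ _ class0) _.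
  by rewrite -mulrA; nra.
apply: le_trans (planted_mixture_L1_le q_gt0 q_lt1 eta0 class0 disj) _.
rewrite lerD2l -mulrA [eta^-1 * _]mulrC mulrA ler_wpM2r ?invr_ge0 ?(ltW eta0) //.
rewrite lerBlDl; apply: le_trans (class_second_moment inj0) _.
have sumE : \sum_t 16 / N ^+ 2 * excess phi0 t = 16 * S.
  by rewrite -mulr_sumr /S /mean_excess mulrA.
apply: le_trans (prod_1D_le _ _) _.
- move=> t; rewrite mulr_ge0 ?excess_ge0 // mulr_ge0 ?invr_ge0 ?exprn_ge0 ?ler0n //.
- by rewrite sumE.
- by rewrite sumE; lra.
Qed.

(** Both laws are averages over the restriction of the embedding to [U], so the triangle inequality
    reduces the claim to the bound on each class. As that bound is linear in [mean_excess], it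
    averages directly. *)
Lemma dTV_embedding_core_le (eta : R) : (1 < n)%N -> 0 < eta -> eta <= 1 ->
  dTV (transcript_law Q (embedding_law Gam q))
      (transcript_law Q (embedding_law (induced U) q)) <=
  eta + 64 / eta * mean (embeddings Gam n) mean_excess.
Proof.
move=> n1 eta0 eta1.
have x0 : 'I_n by apply: (@Ordinal _ 0); lia.
have lawcore : embedding_law (induced U) q = unif_mixture (embeddings Gam n)
    (fun phi => planted_law q (core_edges U phi)).
  by apply/funext => G; rewrite (embedding_law_induced _ U Gam_small x0).
have emb0 := embeddings_neq0 Gam_small.
have le_emb : mean (embeddings Gam n) (fun phi => eta + 64 / eta * mean_excess phi) =
    eta + 64 / eta * mean (embeddings Gam n) mean_excess.
  by rewrite meanD mean_const // meanZ.
apply: (@le_trans _ _ (\sum_s `|transcript_law Q (embedding_law Gam q) s -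
    transcript_law Q (embedding_law (induced U) q) s|)).
  (* The factor 1/2 in the total variation distance is given away. *)
  rewrite /dTV ler_piMl ?sumr_ge0 //; lra.
rewrite -le_emb; apply: (@le_trans _ _ (\sum_s mean (embeddings Gam n) (fun phi0 =>
    `|mean (core_class U phi0) (fun phi =>
             transcript_law Q (planted_law q (image_edges phi)) s)
           - transcript_law Q (planted_law q (core_edges U phi0)) s|))).
  apply: ler_sum => s _; rewrite lawcore !transcript_mixture.
  rewrite (mean_classes (restrict U)) -meanB.
  exact: ler_norm_mean.
rewrite -mean_sum; apply: ler_mean => phi /embeddingsP inj.
exact: class_L1_le.
Qed.

End ClassSecondMoment.

(** * Averaging the excess over the embedded core *)

Lemma expr_sub1_binomial (R : comNzRingType) (a : R) (k m : nat) : (k <= m)%N ->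
  a ^+ k - 1 = \sum_(1 <= r < m.+1) (a - 1) ^+ r * 'C(k, r)%:R.
Proof.
move=> km; rewrite -{1}[a](subrKC 1) exprDn.
rewrite -(big_mkord xpredT (fun i => (1 ^+ (k - i) * (a - 1) ^+ i) *+ 'C(k, i))).
rewrite big_ltn // expr0 expr1n mulr1 bin0 mulr1n [X in X - 1]addrC addrK.
(* The terms with r > k vanish; the padding up to [m] gives all overlaps, whatever their size, a
   common range of summation. *)
rewrite [RHS](@big_cat_nat _ _ _ k.+1) //= [X in _ = _ + X](_ : _ = 0).
  by rewrite addr0; apply: eq_bigr => r _; rewrite expr1n mul1r mulr_natr.
by rewrite big_nat big1 // => r /andP[kr _]; rewrite bin_small // mulr0.
Qed.

Section MeanExcess.
Variables (R : realType) (Gam : sgraph) (n : nat) (q : R) (U : {set Gam}).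
Hypotheses (Gam_small : (#|Gam| <= n)%N) (n_gt1 : (1 < n)%N).
Variable Q : {set vpair n}.

(** The binomial coefficient counts the r-subsets of [D] that [phi] maps into [T], and each r-subset
    lands there with probability (|T|)_r / (n)_r. *)
Lemma mean_binomial (D : {set Gam}) (T : {set 'I_n}) (r : nat) :
  mean (embeddings Gam n) (fun phi => 'C(#|[set u in D | phi u \in T]|, r)%:R) =
  'C(#|D|, r)%:R * ((#|T| ^_ r)%:R / (n ^_ r)%:R) :> R.
Proof.
have x0 : 'I_n by apply: (@Ordinal _ 0); lia.
have -> : mean (embeddings Gam n) (fun phi => 'C(#|[set u in D | phi u \in T]|, r)%:R) =
    \sum_(S : {set Gam} | (S \subset D) && (#|S| == r))
      mean (embeddings Gam n) (fun phi => [forall u in S, phi u \in T]%:R) :> R.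
  rewrite -mean_sum; apply: eq_mean => phi _.
  rewrite -cards_draws -sum1_card natr_sum.
  rewrite [RHS](eq_bigr (fun S : {set Gam} =>
    if [forall u in S, phi u \in T] then 1 else 0)); last first.
    by move=> S _; case: [forall u in S, _].
  rewrite -big_mkcondr /=.
  apply: eq_bigl => S; rewrite inE [RHS]andbAC; congr (_ && _).
  apply/fintype.subsetP/andP => [sub|[/fintype.subsetP subD /forall_inP ST] u uS].
    split; first by apply/fintype.subsetP => u /sub; rewrite inE => /andP[].
    by apply/forall_inP => u /sub; rewrite inE => /andP[].
  by rewrite inE subD ?ST.
rewrite (eq_bigr (fun=> (#|T| ^_ r)%:R / (n ^_ r)%:R)).
  rewrite -cards_draws sumr_const -[LHS]mulr_natl; congr (_%:R * _).
  by apply: eq_card => S; rewrite inE.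
move=> S /andP[_ /eqP cardS]; rewrite mean_indicator.
have -> : [set phi in embeddings Gam n | [forall u in S, phi u \in T]] =
    [set phi : {ffun Gam -> 'I_n} | injectiveb phi & [forall u in S, phi u \in T]].
  by apply/setP => phi; rewrite !inE.
rewrite card_injections_into // card_ord card_embeddings cardS.
have rV : (r <= #|Gam|)%N by rewrite -cardS max_card.
have -> : (n ^_ #|Gam| = n ^_ r * (n - r) ^_ (#|Gam| - r))%N by rewrite -ffactD subnKC.
have b0 : ((n - r) ^_ (#|Gam| - r))%:R != 0 :> R.
  by rewrite pnatr_eq0 -lt0n ffact_gt0; lia.
by rewrite !natrM invfM mulrACA mulfV // mulr1.
Qed.

(** Expand each [excess] in powers of 1/q - 1 and average with [T] the queried neighbours of x: the
    sum over w and w' builds [Theta], the sum over x builds [zeta]. *)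
Lemma mean_mean_excess :
  mean (embeddings Gam n) (mean_excess q U Q) =
  ((n%:R - #|U|%:R) ^+ 2)^-1 *
    \sum_(1 <= r < #|U|.+1) (q^-1 - 1) ^+ r * (Theta U r)%:R * zeta R r Q.
Proof.
have leUn : (#|U| <= n)%N by apply: leq_trans Gam_small; exact: max_card.
rewrite -natrB // /mean_excess meanZ; congr (_ * _); rewrite mean_sum.
pose common w w' := nbrs_in U w :&: nbrs_in U w'.
pose f w w' i r : R := (q^-1 - 1) ^+ r * ('C(#|common w w'|, r)%:R *
  ((query_degree Q i ^_ r)%:R / (n ^_ r)%:R)).
have termE (t : Gam * Gam * 'I_n) :
    mean (embeddings Gam n) (fun phi => excess q U Q phi t) =
    (outside U t)%:R * \sum_(1 <= r < #|U|.+1) f t.1.1 t.1.2 t.2 r.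
  rewrite /excess meanZ; congr (_ * _).
  under eq_bigr => r _ do rewrite /f -mean_binomial -meanZ.
  rewrite -mean_sum; apply: eq_mean => phi _; apply: expr_sub1_binomial.
  by apply: subset_leq_card; apply/fintype.subsetP => u; rewrite !inE => /andP[/andP[/andP[]]].
rewrite (eq_bigr _ (fun t _ => termE t)).
rewrite -(pair_bigA _ (fun p i => (outside U (p, i))%:R * \sum_(1 <= r < #|U|.+1) f p.1 p.2 i r)).
rewrite -(pair_bigA _ (fun w w' => \sum_(i < n) (outside U (w, w', i))%:R *
  \sum_(1 <= r < #|U|.+1) f w w' i r)) /=.
transitivity (\sum_(w in ~: U) \sum_(w' in ~: U) \sum_(i < n) \sum_(1 <= r < #|U|.+1) f w w' i r).
  rewrite [RHS]big_mkcond; apply: eq_bigr => w _; rewrite inE /outside /=.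
  case: (w \in U) => /=; first by rewrite big1 // => w' _; rewrite big1 // => i _; rewrite mul0r.
  rewrite [RHS]big_mkcond; apply: eq_bigr => w' _; rewrite inE.
  case: (w' \in U) => /=; first by rewrite big1 // => i _; rewrite mul0r.
  by apply: eq_bigr => i _; rewrite mul1r.
transitivity (\sum_(w in ~: U) \sum_(1 <= r < #|U|.+1) \sum_(w' in ~: U) \sum_(i < n) f w w' i r).
  apply: eq_bigr => w _; rewrite [RHS]exchange_big; apply: eq_bigr => w' _.
  exact: exchange_big.
rewrite exchange_big /=; apply: eq_bigr => r _.
rewrite /Theta -mulrA natr_sum mulr_suml mulr_sumr; apply: eq_bigr => w _.
rewrite natr_sum mulr_suml mulr_sumr; apply: eq_bigr => w' _.
by rewrite /zeta mulr_sumr mulr_sumr.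
Qed.

End MeanExcess.

(** * Total variation, suprema over query sets, and the limit *)

Lemma dTV_ge0 (R : realType) (T : finType) (P P' : T -> R) : 0 <= dTV P P'.
Proof. by rewrite mulr_ge0 ?sumr_ge0 // invr_ge0. Qed.

Lemma dTV_triangle (R : realType) (T : finType) (P P' P'' : T -> R) :
  dTV P P'' <= dTV P P' + dTV P' P''.
Proof.
rewrite /dTV -mulrDr ler_wpM2l ?invr_ge0 // -big_split; apply: ler_sum => t _.
exact: ler_distD.
Qed.

Lemma le_sup_budget (R : realType) n B (f : {set vpair n} -> R) (Q : {set vpair n}) :
  (#|Q| <= B)%N -> f Q <= sup_budget B f.
Proof. exact: le_bigmax_cond. Qed.

Lemma sup_budget_le (R : realType) n B (f : {set vpair n} -> R) (c : R) :
  (forall Q : {set vpair n}, (#|Q| <= B)%N -> f Q <= c) -> sup_budget B f <= c.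
Proof. by move=> le_f; apply: bigmax_le => //; apply: le_f; rewrite cards0. Qed.

Theorem theorem2 (R : realType) (q : R) (Gam : nat -> sgraph)
    (U : forall n : nat, {set Gam n}) (B : nat -> nat)
    (q_gt0 : 0 < q) (q_lt1 : q < 1)
    (Gam_no_isolated : forall n : nat, (1 < n)%N -> no_isolated (Gam n))
    (Gam_has_edge : forall n : nat, (1 < n)%N -> has_edge (Gam n))
    (Gam_small : forall n : nat, (1 < n)%N -> (#|Gam n| <= n)%N)
    (U_cover : forall n : nat, (1 < n)%N -> vertex_cover (U n))
    (core_undetectable :
      ((fun n : nat => sup_budget (B n) (fun Q : {set vpair n} =>
          dTV (transcript_law Q (embedding_law (induced (U n)) q))
              (transcript_law Q (null_law q))))
        @ \oo --> (0 : R))%classic)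
    (overlap_small :
      ((fun n : nat => sup_budget (B n) (fun Q : {set vpair n} =>
          ((n%:R - #|U n|%:R) ^+ 2)^-1 *
          \sum_(1 <= r < #|U n|.+1)
             (q^-1 - 1) ^+ r * (Theta (U n) r)%:R * zeta R r Q))
        @ \oo --> (0 : R))%classic) :
  weak_detection_impossible Gam q B.
Proof.
apply/cvgrPdist_le => eps eps0.
(* The error splits into three parts of at most eps / 3: [eta], the excess term multiplied by 64 /
   eta, and the detection of the core. The cap at 1 meets the condition of [class_L1_le]. *)
pose eta := Num.min 1 (eps / 3).
have eta0 : 0 < eta by rewrite lt_min ltr01 divr_gt0.
have eta1 : eta <= 1 by rewrite ge_min lexx.
have eta_eps : eta <= eps / 3 by rewrite ge_min lexx orbT.
have K0 : 0 < eps / 3 / (64 / eta) by rewrite !divr_gt0.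
move/cvgr0Pnorm_le: core_undetectable => /(_ (eps / 3) (divr_gt0 eps0 (ltr0Sn _ _))) core.
move/cvgr0Pnorm_le: overlap_small => /(_ _ K0) overlap.
near=> n.
(* The graph hypotheses start at n = 2, the first n at which a graph on at most n vertices can have
   an edge. *)
have n_gt1 : (1 < n)%N by near: n; exact: nbhs_infty_ge.
(* The distance of the risk from 1 is the supremum itself, nonnegative because the empty query set
   is admissible. *)
rewrite /opt_risk subKr ger0_norm; last first.
  by apply: le_trans (dTV_ge0 _ _) (@le_sup_budget R n (B n) _ finset.set0 _); rewrite cards0.
apply: sup_budget_le => Q QB; rewrite copy_law_embedding.
apply: le_trans (dTV_triangle _ (transcript_law Q (embedding_law (induced (U n)) q)) _) _.
have core_le : dTV (transcript_law Q (embedding_law (induced (U n)) q))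
    (transcript_law Q (null_law q)) <= eps / 3.
  apply: le_trans (le_sup_budget (fun Q => dTV (transcript_law Q _) (transcript_law Q _)) QB) _.
  by apply: le_trans (ler_norm _) _; near: n.
have := dTV_embedding_core_le (Gam_small n n_gt1) (U_cover n n_gt1) q_gt0 q_lt1 Q n_gt1 eta0 eta1.
rewrite mean_mean_excess ?Gam_small //.
set K := (X in 64 / eta * X); have K_le : K <= eps / 3 / (64 / eta).
  apply: le_trans (le_sup_budget (fun Q => _^-1 * \sum_(1 <= r < _) _ * zeta R r Q) QB) _.
  by apply: le_trans (ler_norm _) _; near: n.
move: K_le; rewrite ler_pdivlMr ?divr_gt0 // mulrC => K_le embed_le.
by lra.
Unshelve. all: by end_near.
Qed.
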